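(* Let $H$ be a complex Hilbert space, let $(\alpha_1,\dots,\alpha_n)$ be an $n$-tuple of linearly independent vectors in $H$, and let $\gamma\in H$. Let $D(\gamma)=\inf\{\|\gamma-\beta\|:\beta\in\operatorname{span}\{\alpha_1,\dots,\alpha_n\}\}$. Then $$D(\gamma)=\sqrt{\frac{\det\big(\mathrm{Gram}(\gamma,\alpha_1,\dots,\alpha_n)\big)}{\det\big(\mathrm{Gram}(\alpha_1,\dots,\alpha_n)\big)}}.$$
   Context: For vectors $\xi_1,\dots,\xi_m\in H$, $\mathrm{Gram}(\xi_1,\dots,\xi_m)\in M_m(\mathbb C)$ denotes the $m\times m$ matrix with $(i,j)$ entry $\langle\xi_i,\xi_j\rangle$. *)

(* Defs.v *)
From HB Require Import structures.
From mathcomp Require Import all_boot all_order all_algebra.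
From mathcomp Require Import sesquilinear complex.
From mathcomp Require Import all_classical all_reals all_analysis.

Set Implicit Arguments.
Unset Strict Implicit.
Unset Printing Implicit Defensive.

Import Order.TTheory GRing.Theory Num.Theory.

Local Open Scope classical_set_scope.
Local Open Scope complex_scope.
Local Open Scope ring_scope.

(* A Hilbert space over C = R[i] is a complete normed module H together with a
   positive definite hermitian form (linear on the left, conjugate-linear on
   the right) that induces its norm. *)
Definition induces_norm (R : realType) (H : completeNormedModType R[i])
    (ip : {dot H for Num.conj}) : Prop :=
  forall x : H, `|x| = sqrtC (ip x x).

(* H may be infinite-dimensional, hence is not a vectType, so that [free] and
   [span] of vector.v do not apply. *)
Definition lin_indep (K : fieldType) (V : lmodType K) (n : nat)
    (a : n.-tuple V) : Prop :=
  forall c : 'I_n -> K, \sum_(i < n) c i *: tnth a i = 0 -> forall i, c i = 0.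

Definition lin_span (K : fieldType) (V : lmodType K) (n : nat)
    (a : n.-tuple V) : set V :=
  [set v | exists c : 'I_n -> K, v = \sum_(i < n) c i *: tnth a i].

Definition Gram (R : realType) (H : completeNormedModType R[i])
    (ip : {dot H for Num.conj}) (m : nat) (xi : m.-tuple H) : 'M[R[i]]_m :=
  \matrix_(i < m, j < m) ip (tnth xi i) (tnth xi j).

(* The norm of H takes its (real) values in R[i]; [complex.Re] brings them back
   to R, where infima are available. *)
Definition dist_to_span (R : realType) (H : completeNormedModType R[i])
    (n : nat) (a : n.-tuple H) (g : H) : R :=
  inf [set complex.Re `|g - b| | b in lin_span a].

(* Main.v *)
Require Import Defs.
From HB Require Import structures.
From mathcomp Require Import all_boot all_order all_algebra.
From mathcomp Require Import sesquilinear complex.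
From mathcomp Require Import all_classical all_reals all_analysis.

Set Implicit Arguments.
Unset Strict Implicit.
Unset Printing Implicit Defensive.

Import Order.TTheory GRing.Theory Num.Theory.

Local Open Scope complex_scope.
Local Open Scope ring_scope.

(** Independence makes the Gram matrix [G] of [alpha] invertible, so the normal
    equations [c *m G = (<gamma, alpha_j>)_j] have a solution [c], and
    [p = \sum_i c_i alpha_i] is the orthogonal projection of [gamma] on the
    span.  By Pythagoras the distance is attained at [p].  In the Gram matrix of
    [(gamma, alpha)] the row of [gamma] is then [c] times the other rows, except
    in its first entry, so the determinant is [det G] times the Schur complement
    [<gamma, gamma> - <p, gamma> = |gamma - p|^2]. *)

(** [C] stands for the upper right block times [invmx D], which lets [D] be
    singular. *)
Lemma det_block_mx_Schur (R : comNzRingType) (m n : nat) (A : 'M[R]_m)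
    (B : 'M[R]_(n, m)) (C : 'M[R]_(m, n)) (D : 'M[R]_n) :
  \det (block_mx A (C *m D) B D) = \det (A - C *m B) * \det D.
Proof.
have -> : block_mx A (C *m D) B D
    = block_mx 1%:M C 0 1%:M *m block_mx (A - C *m B) 0 B D.
  by rewrite mulmx_block !mul1mx !mul0mx subrK !add0r.
by rewrite det_mulmx det_ublock det_lblock !det1 !mul1r.
Qed.

Lemma inf_minimum (R : realType) (E : set R) (x : R) :
  E x -> lbound E x -> inf E = x.
Proof.
move=> Ex x_lb; apply/eqP; rewrite eq_le lb_le_inf ?andbT //; last by exists x.
by apply: ge_inf => //; exists x.
Qed.

Section LinearCombination.
Variables (K : fieldType) (V : lmodType K) (n : nat) (a : n.-tuple V).

Definition lin_comb (c : 'rV[K]_n) : V := \sum_i c 0 i *: tnth a i.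

Fact lin_comb_is_linear : linear lin_comb.
Proof.
move=> k c d; rewrite /lin_comb scaler_sumr -big_split /=.
by apply: eq_bigr => i _; rewrite !mxE scalerDl scalerA.
Qed.

HB.instance Definition _ :=
  GRing.isLinear.Build K 'rV[K]_n V *:%R lin_comb lin_comb_is_linear.

Lemma lin_spanP (v : V) : lin_span a v <-> exists c, v = lin_comb c.
Proof.
split=> [[c ->]|[c ->]]; last by exists (c 0).
by exists (\row_i c i); apply: eq_bigr => i _; rewrite mxE.
Qed.

Lemma mem_lin_span (i : 'I_n) : lin_span a (tnth a i).
Proof.
apply/lin_spanP; exists (delta_mx 0 i).
rewrite /lin_comb (bigD1 i) //= big1 => [|j j_neq_i].
  by rewrite mxE !eqxx scale1r addr0.
by rewrite mxE (negPf j_neq_i) andbF scale0r.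
Qed.

Lemma lin_spanB (u v : V) : lin_span a u -> lin_span a v -> lin_span a (u - v).
Proof.
move=> /lin_spanP[c ->] /lin_spanP[d ->].
by apply/lin_spanP; exists (c - d); rewrite linearB.
Qed.

Lemma lin_comb_eq0 (c : 'rV[K]_n) : lin_indep a -> lin_comb c = 0 -> c = 0.
Proof. by move=> a_indep /a_indep c0; apply/rowP => i; rewrite c0 mxE. Qed.

End LinearCombination.

Definition gram_mx (R U V : Type) (form : U -> V -> R) (m n : nat)
    (u : m.-tuple U) (v : n.-tuple V) : 'M[R]_(m, n) :=
  \matrix_(i, j) form (tnth u i) (tnth v j).

Lemma gram_mx_cons (R U V : Type) (form : U -> V -> R) (m n : nat)
    (x : U) (y : V) (u : m.-tuple U) (v : n.-tuple V) :
  gram_mx form [tuple of x :: u] [tuple of y :: v] =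
    block_mx (gram_mx form [tuple x] [tuple y]) (gram_mx form [tuple x] v)
             (gram_mx form u [tuple y]) (gram_mx form u v)
    :> 'M[R]_(1 + m, 1 + n).
Proof.
apply/matrixP=> i j; rewrite -(fintype.splitK i) -(fintype.splitK j).
by case: (fintype.split i) => i'; case: (fintype.split j) => j' /=;
  rewrite ?block_mxEul ?block_mxEur ?block_mxEdl ?block_mxEdr !mxE
          ?(ord1 i') ?(ord1 j') ?lshift0 ?rshift1 ?tnth0 ?tnthS.
Qed.

Definition orth_proj (K : fieldType) (V : lmodType K) (form : V -> V -> K)
    (n : nat) (a : n.-tuple V) (g p : V) : Prop :=
  lin_span a p /\ forall b, lin_span a b -> form (g - p) b = 0.

Section SesquilinearGram.
Variables (K : fieldType) (V : lmodType K) (theta : K -> K).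
Variable form : {bilinear V -> V -> K | *%R & theta \; *%R}.
Variables (n : nat) (a : n.-tuple V).

Lemma gram_mx_lin_comb (m : nat) (c : 'rV[K]_n) (v : m.-tuple V) :
  gram_mx form [tuple lin_comb a c] v = c *m gram_mx form a v.
Proof.
apply/rowP => j; rewrite !mxE linear_sumlz.
by apply: eq_bigr => i _; rewrite linearZl_LR mxE.
Qed.

Lemma form_lin_span_eq0 (x b : V) :
  (forall i, form x (tnth a i) = 0) -> lin_span a b -> form x b = 0.
Proof.
move=> x_orth [c ->]; rewrite linear_sumr big1 // => i _.
by rewrite linearZr_LR /= x_orth mulr0.
Qed.

Lemma orth_proj_exists (g : V) :
  gram_mx form a a \in unitmx -> exists p, orth_proj form a g p.
Proof.
move=> G_unit; pose c := gram_mx form [tuple g] a *m invmx (gram_mx form a a).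
exists (lin_comb a c); split; first by apply/lin_spanP; exists c.
move=> b; apply: form_lin_span_eq0 => j.
have normal_eq : gram_mx form [tuple lin_comb a c] a = gram_mx form [tuple g] a.
  by rewrite gram_mx_lin_comb mulmxKV.
by move/rowP/(_ j): normal_eq; rewrite !mxE linearBl /= => ->; rewrite subrr.
Qed.

Lemma det_gram_mx_cons (g p : V) : orth_proj form a g p ->
  \det (gram_mx form [tuple of g :: a] [tuple of g :: a]) =
    form (g - p) (g - p) * \det (gram_mx form a a).
Proof.
move=> [p_span r_orth]; have /lin_spanP[c p_comb] := p_span.
have g_row : gram_mx form [tuple g] a = c *m gram_mx form a a.
  rewrite -gram_mx_lin_comb -p_comb; apply/rowP => j; rewrite !mxE.
  by apply/eqP; rewrite -subr_eq0 -linearBl r_orth //; exact: mem_lin_span.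
rewrite gram_mx_cons g_row (@det_block_mx_Schur _ 1 n); congr (_ * _).
rewrite -gram_mx_lin_comb -p_comb det_mx11 !mxE -linearBl /=.
by rewrite [RHS]linearBr /= (r_orth p p_span) subr0.
Qed.

End SesquilinearGram.

Section DotForm.
Variables (K : numClosedFieldType) (V : lmodType K).
Variable form : {dot V for Num.conj}.
Variables (n : nat) (a : n.-tuple V).

Lemma gram_mx_unit : lin_indep a -> gram_mx form a a \in unitmx.
Proof.
move=> a_indep; rewrite -row_free_unit; apply: inj_row_free => c cG0.
apply: (lin_comb_eq0 a_indep); apply/eqP; rewrite -(dnorm_eq0 form); apply/eqP.
apply: (form_lin_span_eq0 (a := a)); last by apply/lin_spanP; exists c.
by move=> j; move/rowP/(_ j): cG0; rewrite -gram_mx_lin_comb !mxE.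
Qed.

Lemma orth_proj_min (g p b : V) : orth_proj form a g p -> lin_span a b ->
  form (g - p) (g - p) <= form (g - b) (g - b).
Proof.
move=> [p_span r_orth] b_span; rewrite -[g - b](subrKA p).
have pb_orth : form (g - p) (p - b) = 0 by apply/r_orth/lin_spanB.
by rewrite (hnormDd pb_orth) lerDl dnorm_ge0.
Qed.

End DotForm.

Section HilbertSpace.
Variables (R : realType) (H : completeNormedModType R[i]).
Variables (ip : {dot H for Num.conj}) (n : nat).

Lemma GramE (a : n.-tuple H) : Gram ip a = gram_mx ip a a.
Proof. by []. Qed.

Lemma dist_to_span_orth_proj (a : n.-tuple H) (g p : H) :
  induces_norm ip -> orth_proj ip a g p ->
  (dist_to_span a g)%:C = sqrtC (ip (g - p) (g - p)).
Proof.
move=> ip_norm p_proj; rewrite /dist_to_span.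
rewrite (@inf_minimum _ _ (complex.Re `|g - p|)).
- by rewrite RRe_real ?normr_real // ip_norm.
- by exists p => //; case: p_proj.
- move=> _ [b b_span <-]; rewrite -lecR !RRe_real ?normr_real // !ip_norm.
  by rewrite ler_sqrtC ?nnegrE ?dnorm_ge0 // (orth_proj_min p_proj).
Qed.

End HilbertSpace.

Theorem theorem4p1 (R : realType) (H : completeNormedModType R[i])
    (ip : {dot H for Num.conj}) (ip_norm : induces_norm ip)
    (n : nat) (alpha : n.-tuple H) (alpha_indep : lin_indep alpha)
    (gamma : H) :
  (dist_to_span alpha gamma)%:C =
    sqrtC (\det (Gram ip [tuple of gamma :: alpha]) / \det (Gram ip alpha)).
Proof.
have G_unit := gram_mx_unit ip alpha_indep.
have [p p_proj] := orth_proj_exists gamma G_unit.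
rewrite (dist_to_span_orth_proj ip_norm p_proj).
by rewrite !GramE (det_gram_mx_cons p_proj) mulfK // -unitfE -unitmxE.
Qed.
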